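(* For all positive integers $n$, $B_{n,1}(1!u_1,2!u_2,\ldots,n!u_n)=n!u_n$ and $B_{n,n}(u_1)=u_1^n$. When $n\ge 2$ and $[n/2]<k\le n$, $$B_{n,k}(1!u_1,2!u_2,\ldots,(n-k+1)!u_{n-k+1})=n\,B_{n-1,k-1}(1!u_1,2!u_2,\ldots,(n-k+1)!u_{n-k+1})\big|_{k_1\to k_1+1}.$$ When $n\ge 4$ and $2\le k\le [n/2]$, $$B_{n,k}(1!u_1,2!u_2,\ldots,(n-k+1)!u_{n-k+1})=n\,B_{n-1,k-1}(1!u_1,2!u_2,\ldots,(n-k+1)!u_{n-k+1})\big|_{k_1\to k_1+1}+(n)_k\,B_{n-k,k}(1!u_2,2!u_3,\ldots,(n-2k+1)!u_{n-2k+2}).$$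
   Context: $[x]$ denotes the integer part of $x$ and $(n)_k=n(n-1)\cdots(n-k+1)$ the falling factorial. For integers $1\le k\le n$, the partial exponential Bell polynomial is $$B_{n,k}(x_1,\ldots,x_{n-k+1})=n!\sum_{\Lambda^k_n}\prod_{j=1}^{n-k+1}\frac{1}{k_j!}\Big(\frac{x_j}{j!}\Big)^{k_j},$$ where the sum is over $\Lambda^k_n=\{(k_1,\ldots,k_{n-k+1}): \sum_j k_j=k,\ \sum_j jk_j=n,\ k_j\in\mathbb{Z}_{\ge 0}\}$. The notation $|_{k_1\to k_1+1}$ means that in each summand of the defining sum $k_1$ is replaced by $k_1+1$ (the index set being unchanged), i.e. $$B_{n-1,k-1}(1!u_1,\ldots,(n-k+1)!u_{n-k+1})\big|_{k_1\to k_1+1}=(n-1)!\sum_{(k_1,\ldots,k_{n-k+1})\in\Lambda^{k-1}_{n-1}}\frac{u_1^{k_1+1}}{(k_1+1)!}\prod_{j=2}^{n-k+1}\frac{u_j^{k_j}}{k_j!}.$$ *)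

(* Defs.v *)
From mathcomp Require Import all_boot all_algebra.

Set Implicit Arguments.
Unset Strict Implicit.
Unset Printing Implicit Defensive.

Import GRing.Theory.
Local Open Scope ring_scope.

(* The index set Lambda^k_n. Indices are shifted by one: the exponent k_j of   *)
(* the usual notation (1 <= j <= n - k + 1) is the value of m at j - 1. Taking *)
(* values in 'I_k.+1 loses nothing, since \sum_j k_j = k forces k_j <= k.      *)
Definition bell_index (n k : nat) : {set {ffun 'I_(n - k).+1 -> 'I_k.+1}} :=
  [set m : {ffun 'I_(n - k).+1 -> 'I_k.+1} |
    (\sum_(j < (n - k).+1) m j == k)%N &&
    (\sum_(j < (n - k).+1) j.+1 * m j == n)%N].

(* Here [e i] is the exponent k_(i+1). A sequence [x : nat -> F] stands for   *)
(* (x_1, x_2, ...), so that [x 0] is never used.                              *)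
Definition bell_summand (F : fieldType) (N : nat) (x : nat -> F)
    (e : 'I_N -> nat) : F :=
  \prod_(i < N) (((e i)`!%:R)^-1 * (x i.+1 / (i.+1)`!%:R) ^+ e i).

(* B_{n,k}(x_1, ..., x_(n-k+1)), for 1 <= k <= n. *)
Definition bell (F : fieldType) (n k : nat) (x : nat -> F) : F :=
  n`!%:R * \sum_(m in bell_index n k)
    bell_summand x (fun i : 'I_(n - k).+1 => m i : nat).

(* B_{n,k}(x_1, ..., x_(n-k+1)) |_{k_1 -> k_1 + 1}: every summand has its     *)
(* exponent k_1 (at ordinal 0) incremented, over the same index set.          *)
Definition bell_shift1 (F : fieldType) (n k : nat) (x : nat -> F) : F :=
  n`!%:R * \sum_(m in bell_index n k)
    bell_summand x (fun i : 'I_(n - k).+1 => (m i + (i == ord0))%N).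

(* Main.v *)
(** Split the index set of B_{n,k} according to whether k_1 > 0 or k_1 = 0.
    Decrementing k_1 maps the first part bijectively onto the index set of
    B_{n-1,k-1}. In the second part subtract the two constraints: k_2, k_3, ...
    are then the exponents of a summand of B_{n-k,k} in the variables u_2, u_3,
    ..., and there is no such summand unless n - k >= k. *)
Require Import Defs.
From mathcomp Require Import all_boot all_algebra.
From mathcomp Require Import zify.

Set Implicit Arguments.
Unset Strict Implicit.

Import GRing.Theory.
Local Open Scope ring_scope.

(** Totalising by 0 lets exponents be read at shifted indices, across ordinal types of different
    sizes. The default is harmless, because an absent variable has exponent 0. *)
Definition extend0 (N K : nat) (m : {ffun 'I_N -> 'I_K}) (i : nat) : nat :=
  oapp (fun j : 'I_N => m j : nat) 0%N (insub i).

Lemma extend0_ord (N K : nat) (m : {ffun 'I_N -> 'I_K}) (j : 'I_N) :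
  extend0 m j = m j.
Proof. by rewrite /extend0 valK. Qed.

Lemma extend0_out (N K : nat) (m : {ffun 'I_N -> 'I_K}) (i : nat) :
  (N <= i)%N -> extend0 m i = 0%N.
Proof. by move=> le_Ni; rewrite /extend0 insubN // -leqNgt. Qed.

Lemma extend0_le (N K : nat) (m : {ffun 'I_N -> 'I_K.+1}) (i : nat) :
  (extend0 m i <= K)%N.
Proof. by rewrite /extend0; case: insub => //= j; rewrite -ltnS. Qed.

Lemma big_ord_trim (R : Type) (idx : R) (op : Monoid.law idx) (N M : nat)
    (G : nat -> R) :
  (N <= M)%N -> (forall i, (N <= i < M)%N -> G i = idx) ->
  \big[op/idx]_(i < M) G i = \big[op/idx]_(i < N) G i.
Proof.
move=> le_NM G1; rewrite (big_ord_widen _ _ le_NM) [RHS]big_mkcond /=.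
apply: eq_bigr => i _; case: ltnP => // le_Ni.
by rewrite G1 // le_Ni ltn_ord.
Qed.

Lemma weighted_sumS (N : nat) (e : nat -> nat) :
  (\sum_(j < N) j.+1 * e j = \sum_(j < N) j * e j + \sum_(j < N) e j)%N.
Proof. by rewrite -big_split; apply: eq_bigr => j _; rewrite mulSn addnC. Qed.

(** Subtracting the constraints leaves [\sum_j j * e j = n - k], and a nonzero [e j] would
    contribute at least [j] to it. This is why cutting off the slots beyond [n - k] loses
    nothing. *)
Lemma weighted_sum_support (N n k : nat) (e : nat -> nat) :
  (\sum_(j < N) e j = k)%N -> (\sum_(j < N) j.+1 * e j = n)%N ->
  forall j, (j < N)%N -> (n - k < j)%N -> e j = 0%N.
Proof.
move=> Sk Sn j lt_jN lt_nkj; rewrite weighted_sumS Sk in Sn.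
have le_j : (j * e j <= \sum_(i < N) i * e i)%N.
  by rewrite (bigD1 (Ordinal lt_jN)) //= leq_addr.
by case: (e j) le_j => // a; nia.
Qed.

Lemma bell_indexP (n k : nat) (m : {ffun 'I_(n - k).+1 -> 'I_k.+1}) :
  reflect ((\sum_(j < (n - k).+1) m j = k)%N /\
           (\sum_(j < (n - k).+1) j.+1 * m j = n)%N)
          (m \in bell_index n k).
Proof. by rewrite inE; apply: (iffP andP) => -[/eqP-> /eqP->]. Qed.

Lemma eq_bell_summand (F : fieldType) (N : nat) (x : nat -> F)
    (e e' : 'I_N -> nat) :
  e =1 e' -> bell_summand x e = bell_summand x e'.
Proof. by move=> eqe; apply: eq_bigr => i _; rewrite eqe. Qed.

Lemma natf_fact_neq0 (F : fieldType) (n : nat) :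
  [pchar F] =i pred0 -> n`!%:R != 0 :> F.
Proof. by move=> F0; rewrite ((pcharf0P F).1 F0) -lt0n fact_gt0. Qed.

Lemma bell_n1 (F : fieldType) (F0 : [pchar F] =i pred0) (u : nat -> F)
    (n : nat) :
  (1 <= n)%N -> bell n 1 (fun j => j`!%:R * u j) = n`!%:R * u n.
Proof.
case: n => // n _; rewrite /bell.
pose m0 : {ffun 'I_(n.+1 - 1).+1 -> 'I_2} := [ffun i => inord (i == ord_max)].
have m0E i : m0 i = (i == ord_max) :> nat by rewrite ffunE inordK; case: eqP.
rewrite (big_pred1 m0) => [|m].
  congr (_ * _); rewrite /bell_summand (bigD1 ord_max) //= big1 ?mulr1.
    rewrite m0E eqxx subn1 /= expr1 invr1 mul1r mulrAC divff ?mul1r //.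
    exact: natf_fact_neq0.
  by move=> i /negPf ne_i; rewrite m0E ne_i expr0 invr1 mulr1.
rewrite /=; apply/bell_indexP/eqP => [[S1 Sn]|->].
  have m_max : (m ord_max = 1 :> nat)%N.
    case: (posnP (m ord_max)) => [m_max0|]; last first.
      by have := ltn_ord (m ord_max); lia.
    (* With exponent 0 at the last slot, every weight in use is at most [n]. The single unit of
       exponent then gives a weighted sum of at most [n], short of the required [n.+1]. *)
    suff : (\sum_(j < (n.+1 - 1).+1) j.+1 * m j
            <= \sum_(j < (n.+1 - 1).+1) n * m j)%N.
      by rewrite -big_distrr /= S1 Sn; lia.
    apply: leq_sum => j _; case: (eqVneq j ord_max) => [->|ne_j].
      by rewrite m_max0 !muln0.
    rewrite leq_mul2r; apply/orP; right.
    by move: ne_j; rewrite -val_eqE /=; have := ltn_ord j; lia.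
  apply/ffunP => i; apply/val_inj; rewrite /= m0E.
  have [->|ne_i] := eqVneq i ord_max; first exact: m_max.
  move: S1; rewrite (bigD1 ord_max) //= m_max (bigD1 i) //=; lia.
split; rewrite (bigD1 ord_max) //= big1 ?m0E ?eqxx; try lia.
- by move=> i /negPf ne_i; rewrite m0E ne_i.
- by move=> i /negPf ne_i; rewrite m0E ne_i muln0.
Qed.

Lemma bell_nn (F : fieldType) (F0 : [pchar F] =i pred0) (u : nat -> F)
    (n : nat) :
  bell n n u = u 1%N ^+ n.
Proof.
rewrite /bell.
pose m0 : {ffun 'I_(n - n).+1 -> 'I_n.+1} := [ffun => ord_max].
(* For a variable [n], [n - n] does not compute to 0, so that this type has one element only up to a
   proof. *)
have uniq_ord i : i = ord0 :> 'I_(n - n).+1.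
  by apply/val_inj; have := ltn_ord i; rewrite /=; lia.
have big_ord1E (R : Type) (idx : R) (op : Monoid.com_law idx)
    (G : 'I_(n - n).+1 -> R) :
    \big[op/idx]_(i < (n - n).+1) G i = G ord0.
  by rewrite (big_pred1 ord0) // => i; rewrite /= (uniq_ord i).
rewrite (big_pred1 m0) => [|m].
  rewrite /bell_summand big_ord1E ffunE /= divr1 mulVKf //.
  exact: natf_fact_neq0.
rewrite /=; apply/bell_indexP/eqP => [[+ _]|->].
  rewrite big_ord1E => m_n; apply/ffunP => i.
  by apply/val_inj; rewrite (uniq_ord i) ffunE.
by rewrite !big_ord1E ffunE /= mul1n.
Qed.

(** Since [n.+1 - k.+1] computes to [n - k], both index sets have the same slots; only the range of
    the exponents differs. *)
Lemma bell_gt0_part (F : fieldType) (x : nat -> F) (n k : nat) :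
  \sum_(m in bell_index n.+1 k.+1 | (0 < m ord0)%N)
     bell_summand x (fun i : 'I_(n.+1 - k.+1).+1 => m i : nat)
  = \sum_(m in bell_index n k)
     bell_summand x (fun i : 'I_(n - k).+1 => (m i + (i == ord0))%N).
Proof.
pose N := (n - k)%N.
pose incr (m : {ffun 'I_N.+1 -> 'I_k.+1}) : {ffun 'I_N.+1 -> 'I_k.+2} :=
  [ffun i => inord (m i + (i == ord0))].
pose decr (m : {ffun 'I_N.+1 -> 'I_k.+2}) : {ffun 'I_N.+1 -> 'I_k.+1} :=
  [ffun i => inord (m i - (i == ord0))].
have incrE m i : incr m i = (m i + (i == ord0))%N :> nat.
  by rewrite ffunE inordK //; have := ltn_ord (m i); case: eqP => _; lia.
have sum_incr m : (\sum_(j < N.+1) incr m j = (\sum_(j < N.+1) m j).+1)%N.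
  rewrite !big_ord_recl incrE eqxx addn1 addSn; congr (_ + _).+1.
  by apply: eq_bigr => i _; rewrite incrE addn0.
have wsum_incr m :
    (\sum_(j < N.+1) j.+1 * incr m j = (\sum_(j < N.+1) j.+1 * m j).+1)%N.
  rewrite !big_ord_recl incrE eqxx addn1 !mul1n addSn; congr (_ + _).+1.
  by apply: eq_bigr => i _; rewrite incrE addn0.
rewrite (reindex_onto incr decr) /=.
  apply: eq_big => [m|m _]; last by apply: eq_bell_summand => i; rewrite incrE.
  have -> : decr (incr m) = m.
    apply/ffunP => i; apply/val_inj.
    by rewrite ffunE /= incrE addnK inordK // ltn_ord.
  rewrite eqxx andbT incrE eqxx addn1 andbT.
  apply/bell_indexP/bell_indexP; rewrite sum_incr wsum_incr.
    by case=> -[->] [->].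
  by case=> -> ->.
move=> m /andP[/bell_indexP[Sk _] m0].
apply/ffunP => i; apply/val_inj; rewrite /= incrE ffunE.
have [->|ne_i] := eqVneq i ord0.
  by rewrite inordK ?subnK //; have := ltn_ord (m ord0); lia.
rewrite subn0 addn0 inordK //.
(* The value at [i] fits the smaller range: slot 0 already takes at least 1 of the total [k.+1]. *)
rewrite -[X in (_ < X)%N]Sk (bigD1 ord0) //= (bigD1 i) //=.
by rewrite -add1n leq_add // leq_addr.
Qed.

(** Without the first slot all weights in use are at least 2. *)
Lemma bell_index_eq0_le (n k : nat) (m : {ffun 'I_(n - k).+1 -> 'I_k.+1}) :
  m \in bell_index n k -> m ord0 = 0%N :> nat -> (k.*2 <= n)%N.
Proof.
move=> /bell_indexP[Sk Sn] m0; rewrite -Sn -[X in X.*2]Sk -mul2n big_distrr /=.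
apply: leq_sum => j _; have [->|ne_j] := eqVneq j ord0; first by rewrite m0.
by rewrite leq_mul2r; apply/orP; right; move: ne_j; rewrite -val_eqE /=; lia.
Qed.

Lemma bell_eq0_part (F : fieldType) (F0 : [pchar F] =i pred0) (u : nat -> F)
    (n k : nat) :
  (0 < k)%N -> (k.*2 <= n)%N ->
  \sum_(m in bell_index n k | ~~ (0 < m ord0)%N)
     bell_summand (fun j => j`!%:R * u j)
       (fun i : 'I_(n - k).+1 => m i : nat)
  = \sum_(m in bell_index (n - k) k)
     bell_summand (fun j => j`!%:R * u j.+1)
       (fun i : 'I_(n - k - k).+1 => m i : nat).
Proof.
move=> k_gt0 le_2kn.
pose p := (n - k)%N; pose q := (p - k)%N.
(* Thanks to [0 < k], the [q.+1] target slots, moved up by one, fit among the [p.+1] source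
   slots. *)
have lt_qp : (q < p)%N by rewrite /q /p; lia.
pose up (m : {ffun 'I_q.+1 -> 'I_k.+1}) : {ffun 'I_p.+1 -> 'I_k.+1} :=
  [ffun i : 'I_p.+1 => inord (if val i is i'.+1 then extend0 m i' else 0)].
pose down (m : {ffun 'I_p.+1 -> 'I_k.+1}) : {ffun 'I_q.+1 -> 'I_k.+1} :=
  [ffun i : 'I_q.+1 => m (inord i.+1)].
have up0 m : up m ord0 = 0%N :> nat by rewrite ffunE inordK.
have upS m (i : 'I_p) : up m (lift ord0 i) = extend0 m i :> nat.
  by rewrite ffunE /= inordK // ltnS extend0_le.
(* One transfer rule serves both constraints and the product of the summand: a zero exponent always
   contributes the neutral element, so neither the leading zero nor the padding counts. *)
have big_up (R : Type) (idx : R) (op : Monoid.law idx) (G : nat -> nat -> R) m :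
    (forall i, G i 0%N = idx) ->
    \big[op/idx]_(i < p.+1) G i (up m i) = \big[op/idx]_(i < q.+1) G i.+1 (m i).
  move=> G0; rewrite big_ord_recl up0 G0 Monoid.mul1m.
  under eq_bigr do rewrite upS.
  rewrite (@big_ord_trim _ _ _ q.+1 p (fun i => G i.+1 (extend0 m i))) //.
    by apply: eq_bigr => i _; rewrite extend0_ord.
  by move=> i /andP[le_qi _]; rewrite extend0_out.
have sum_up m : (\sum_(j < p.+1) up m j = \sum_(j < q.+1) m j)%N.
  exact: (big_up _ _ _ (fun _ a => a)).
have wsum_up m : (\sum_(j < p.+1) j.+1 * up m j
    = \sum_(j < q.+1) j.+1 * m j + \sum_(j < q.+1) m j)%N.
  rewrite (big_up _ _ _ (fun j a => j.+1 * a)%N) => [|i]; last exact: muln0.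
  by rewrite -big_split; apply: eq_bigr => j _; rewrite mulSn addnC.
rewrite (reindex_onto up down) /=.
  apply: eq_big => [m|m _].
    have -> : down (up m) = m.
      apply/ffunP => i; apply/val_inj; rewrite ffunE /=.
      have lt_ip : (i < p)%N by have := ltn_ord i; lia.
      have -> : inord i.+1 = lift ord0 (Ordinal lt_ip) :> 'I_p.+1.
        by apply/val_inj; rewrite /= inordK.
      by rewrite upS /= extend0_ord.
    rewrite eqxx andbT up0 andbT.
    apply/bell_indexP/bell_indexP; rewrite sum_up wsum_up => -[Sk Sn];
      split=> //; last by rewrite Sn Sk subnK //; lia.
    by apply: (canRL (addnK k)); rewrite -[RHS]Sn Sk.
  rewrite /bell_summand.
  rewrite (big_up _ _ _ (fun i a => a`!%:R^-1 *
     (i.+1`!%:R * u i.+1 / i.+1`!%:R) ^+ a)); last first.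
    by move=> i; rewrite expr0 invr1 mulr1.
  (* The factorials attached to [u] cancel on each side, so it does not matter that they differ by
     one index. *)
  apply: eq_bigr => i _.
  by rewrite !(mulrAC _ (u _)) !divff ?natf_fact_neq0.
move=> m /andP[/bell_indexP[Sk Sn]]; rewrite -eqn0Ngt => /eqP m0.
pose e i := extend0 m i.+1.
have eE (i : 'I_p) : e i = m (lift ord0 i).
  by rewrite /e -(extend0_ord m (lift ord0 i)).
have Se : (\sum_(j < p) e j = k)%N.
  by rewrite -[RHS]Sk big_ord_recl m0; apply: eq_bigr => i _; rewrite eE.
(* In [m] the exponent [e j] has weight [j.+2]; lowering each weight by 1 removes [k] in total from
   [n]. *)
have wSe : (\sum_(j < p) j.+1 * e j = p)%N.
  have : (\sum_(j < p) j.+2 * e j = n)%N.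
    by rewrite -[RHS]Sn big_ord_recl m0; apply: eq_bigr => i _; rewrite eE.
  under eq_bigr do rewrite mulSnr.
  by rewrite big_split /= Se /p; lia.
apply/ffunP => i; apply/val_inj => /=.
have [i' ->|->] := unliftP ord0 i; last by rewrite up0 m0.
(* Beyond slot [q], where [up] pads with zeros, the exponents of [m] vanish already, by the support
   bound for [p] and [k]. *)
rewrite upS -eE; have [lt_i'q|le_qi'] := ltnP i' q.+1.
  rewrite -[val i']/(val (Ordinal lt_i'q)) extend0_ord ffunE /= /e.
  by rewrite -(extend0_ord m) inordK // ltnS; exact: ltn_ord.
by rewrite extend0_out // (weighted_sum_support Se wSe).
Qed.

(** The factor [n] comes from [n! = n * (n-1)!]. The remainder is left as a sum, to be shown empty
    or reindexed according to the size of [k]. *)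
Lemma bell_split (F : fieldType) (x : nat -> F) (n k : nat) :
  (0 < n)%N -> (0 < k)%N ->
  bell n k x = n%:R * bell_shift1 n.-1 k.-1 x
    + n`!%:R * \sum_(m in bell_index n k | ~~ (0 < m ord0)%N)
        bell_summand x (fun i : 'I_(n - k).+1 => m i : nat).
Proof.
case: n k => // n [] // k _ _.
rewrite /bell /bell_shift1 -bell_gt0_part mulrA -natrM -factS -mulrDr.
pose pos1 (m : {ffun 'I_(n - k).+1 -> 'I_k.+2}) := (0 < m ord0)%N.
by congr (_ * _); rewrite [LHS](bigID pos1).
Qed.

Unset Implicit Arguments.

Theorem corollary2p2 (F : fieldType) (F0 : [pchar F] =i pred0) (u : nat -> F) :
  (forall n : nat, (1 <= n)%N ->
     bell n 1 (fun j => j`!%:R * u j) = n`!%:R * u n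
     /\ bell n n u = u 1%N ^+ n)
  /\ (forall n k : nat, (2 <= n)%N -> (n./2 < k)%N -> (k <= n)%N ->
     bell n k (fun j => j`!%:R * u j)
     = n%:R * bell_shift1 n.-1 k.-1 (fun j => j`!%:R * u j))
  /\ (forall n k : nat, (4 <= n)%N -> (2 <= k)%N -> (k <= n./2)%N ->
     bell n k (fun j => j`!%:R * u j)
     = n%:R * bell_shift1 n.-1 k.-1 (fun j => j`!%:R * u j)
       + (n ^_ k)%:R * bell (n - k) k (fun j => j`!%:R * u j.+1)).
Proof.
split; first by move=> n n_gt0; split; [exact: bell_n1 | exact: bell_nn].
split=> n k n_gt k_bound k_bound'.
  rewrite bell_split; [|lia..].
  rewrite [X in _ + _ * X]big1 ?mulr0 ?addr0 // => m /andP[m_in].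
  rewrite -eqn0Ngt => /eqP /(bell_index_eq0_le m_in); lia.
rewrite bell_split; [|lia..].
rewrite bell_eq0_part //; [|lia..].
(* The prefactors agree because the falling factorial times [(n - k)!] is [n!]. *)
by rewrite [bell (n - k) k _]/bell mulrA -natrM ffact_fact //; lia.
Qed.
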